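(* Let $(X,\varphi)$ be a finite permutation rack or, more generally, a permutation rack such that all its orbits are finite. Then, for every $n\geqslant 0$, $$\mathrm{HR}_n(X,\varphi)\;\cong\;(\mathbb{Z}S)^{\otimes n}$$ is a free abelian group on the set of $n$-tuples of orbits, where $S=X/\varphi$ is the set of orbits. In particular, there is no torsion in the homology.
   Context: A rack $(X,\rhd)$ is a set $X$ with a binary operation $\rhd$ such that every left multiplication $y\mapsto x\rhd y$ is a bijection and $x\rhd(y\rhd z)=(x\rhd y)\rhd(x\rhd z)$ for all $x,y,z\in X$. A permutation rack $(X,\varphi)$ is a set $X$ with a permutation $\varphi\colon X\to X$ and the rack operation $x\rhd y=\varphi(y)$; its orbits are the orbits of $\varphi$. Rack homology: let $\mathrm{CR}_n(X,\varphi)=(\mathbb{Z}X)^{\otimes n}=\mathbb{Z}(X^n)$ for $n\geqslant 0$ (so $\mathrm{CR}_0=\mathbb{Z}$), with basis elements written as noncommutative monomials $x_1\cdots x_n$, and differential $\mathrm{d}\colon\mathrm{CR}_n\to\mathrm{CR}_{n-1}$, $$\mathrm{d}(x_1\cdots x_n)=\sum_{k=1}^{n-1}(-1)^{k-1}\bigl(x_1\cdots x_{k-1}x_{k+1}\cdots x_n-x_1\cdots x_{k-1}\,\varphi(x_{k+1})\cdots\varphi(x_n)\bigr).$$ The rack homology $\mathrm{HR}_n(X,\varphi)$ is the $n$-th homology of this chain complex. For a set $S$, $\mathbb{Z}S$ is the free abelian group on $S$; tensor products are over $\mathbb{Z}$. *)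

(* Defs.v *)
(* MathComp, with the classical axioms of MathComp-Analysis and the free abelian
   groups {freeg K / int} of multinomials. *)
From HB Require Import structures.
From mathcomp Require Import all_boot all_order all_algebra.
From mathcomp Require Import generic_quotient ring_quotient.
From mathcomp Require Import boolp classical_sets cardinality.
From mathcomp.multinomials Require Import freeg.

Set Implicit Arguments.
Unset Strict Implicit.
Unset Printing Implicit Defensive.

Import GRing.Theory.
Local Open Scope ring_scope.
Local Open Scope quotient_scope.

Definition is_rack (T : Type) (op : T -> T -> T) : Prop :=
  (forall x, bijective (op x)) /\
  (forall x y z, op x (op y z) = op (op x y) (op x z)).

Record permRack := PermRack {
  rack_carrier :> choiceType;
  rack_perm : rack_carrier -> rack_carrier;
  rack_perm_bij : bijective rack_perm
}.
Arguments rack_perm : clear implicits.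

Definition rack_op (X : permRack) (x y : X) : X := rack_perm X y.

Lemma rack_opP (X : permRack) : is_rack (@rack_op X).
Proof. by split=> // x; exact: rack_perm_bij. Qed.

Section Orbits.
Variable X : permRack.
Local Notation phi := (rack_perm X).

(* y = phi^k x for some integer k; for k < 0 this reads x = phi^(-k) y. *)
Definition same_orbit (x y : X) : bool :=
  `[< exists k : nat, y = iter k phi x \/ x = iter k phi y >].

Lemma iter_phi_inj k : injective (iter k phi).
Proof.
elim: k => [|k IH] x y //= /(bij_inj (@rack_perm_bij X)); exact: IH.
Qed.

Lemma same_orbit_equiv : equiv_class_of same_orbit.
Proof.
split=> [x|x y|y x z]; first by apply/asboolP; exists 0; left.
  by apply: asbool_equiv_eq; split=> -[k] [] ->; exists k; [right|left|right|left].
move=> /asboolP[k Hk] /asboolP[l Hl]; apply/asboolP.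
case: Hk Hl => [-> | ->] [-> | Hl].
- by exists (l + k)%N; left; rewrite iterD.
- have [kl|/ltnW lk] := leqP k l.
    exists (l - k)%N; right; apply: (@iter_phi_inj k).
    by rewrite -iterD subnKC.
  exists (k - l)%N; left; apply: (@iter_phi_inj l).
  by rewrite -iterD subnKC.
- have [kl|/ltnW lk] := leqP k l.
    by exists (l - k)%N; left; rewrite -iterD subnK.
  by exists (k - l)%N; right; rewrite -iterD subnK.
- by exists (k + l)%N; right; rewrite Hl iterD.
Qed.

Canonical same_orbit_equivRel := EquivRelPack same_orbit_equiv.

Definition orbits : choiceType := {eq_quot same_orbit}.

Definition orbit_of (x : X) : set X := [set y | same_orbit x y].

End Orbits.

(* [homology f g] is ker g / im f. It is meant for f and g with g \o f = 0: in
   general it quotients ker g by its intersection with im f. *)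
Section Homology.
Variables (A B C : zmodType) (f : {additive A -> B}) (g : {additive B -> C}).

Definition cycle : {pred B} := [pred z | g z == 0].

Lemma cycle_zmod_closed : zmod_closed cycle.
Proof.
split=> [|x y]; rewrite !inE; first by rewrite raddf0.
by move=> /eqP gx /eqP gy; rewrite raddfB gx gy subrr.
Qed.
HB.instance Definition _ := GRing.isZmodClosed.Build B cycle cycle_zmod_closed.

Record cycles := Cycles { cycle_val :> B; _ : cycle_val \in cycle }.
HB.instance Definition _ := [isSub for cycle_val].
HB.instance Definition _ := [Choice of cycles by <:].
HB.instance Definition _ := [SubChoice_isSubZmodule of cycles by <:].

Definition bounding : {pred cycles} :=
  [pred z : cycles | `[< exists c : A, f c = cycle_val z >]].

Lemma bounding_zmod_closed : zmod_closed bounding.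
Proof.
split=> [|x y]; first by apply/asboolP; exists 0; rewrite !raddf0.
move=> /asboolP[a fa] /asboolP[b fb]; apply/asboolP; exists (a - b).
by rewrite raddfB fa fb.
Qed.
HB.instance Definition _ :=
  GRing.isZmodClosed.Build cycles bounding bounding_zmod_closed.

Definition homology : zmodType := Quotient.quot bounding.

End Homology.

Section RackHomology.
Variable X : permRack.
Local Notation phi := (rack_perm X).

(* (ZX)^(tensor n), identified with the free abelian group on X^n. *)
Definition CR (n : nat) : lmodType int := {freeg (n.-tuple X) / int}.

Section Faces.
Variable n : nat.

Lemma face_subproof (h : X -> X) (k : 'I_n.-1) (x : n.-tuple X) :
  size (take k x ++ [seq h y | y <- drop k.+1 x]) == n.-1.
Proof.
case: n k x => [|m] [k //= ltkm] x.
rewrite size_cat size_map size_drop size_takel size_tuple ?subSS.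
  by rewrite subnKC // ltnW.
by rewrite ltnW // ltnW.
Qed.

(* Entries are counted from 0: [face h k] drops the k-th entry and applies h to
   the entries after it. *)
Definition face (h : X -> X) (k : 'I_n.-1) (x : n.-tuple X) : n.-1.-tuple X :=
  Tuple (face_subproof h k x).

Definition boundary_monomial (x : n.-tuple X) : CR n.-1 :=
  \sum_(k < n.-1) (-1) ^+ k *: (<< face id k x >> - << face phi k x >>).

(* For n = 0 the sum is empty, so that [boundary : CR 0 -> CR 0] is the zero map
   and every element of [CR 0] is a cycle. *)
Definition boundary : CR n -> CR n.-1 := fglift boundary_monomial.

HB.instance Definition _ :=
  GRing.isZmodMorphism.Build (CR n) (CR n.-1) boundary
    (lift_is_additive boundary_monomial).

End Faces.

Section ChainComplex.

Let cut (h : X -> X) (k : nat) (s : seq X) :=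
  take k s ++ [seq h y | y <- drop k.+1 s].

Let cut_cut (g h : X -> X) (i j : nat) (s : seq X) :
  (forall y, g (h y) = h (g y)) -> (i <= j)%N ->
  cut g j (cut h i s) = cut h i (cut g j.+1 s).
Proof.
move=> gh; elim: s i j => [|a s IH] [|i] [|j] //= leij; rewrite /cut /=.
- by rewrite !drop0 !take0 /= -map_drop -!map_comp; apply: eq_map => y /=.
- rewrite !drop0 -map_take -map_drop map_cat -!map_comp.
  by congr (_ ++ _); apply: eq_map => y /=.
- by congr cons; exact: IH.
Qed.

Let alternating_double_sum0 (V : zmodType) (T : nat -> nat -> V) m :
  (forall i j, (i <= j)%N -> T j.+1 i = - T i j) ->
  \sum_(i < m.+1) \sum_(j < m) T i j = 0.
Proof.
move=> alt; elim: m => [|m IH]; first by rewrite big1 // => i _; rewrite big_ord0.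
rewrite big_ord_recr /=.
under eq_bigr do rewrite big_ord_recr /=.
rewrite big_split /= IH add0r -big_split big1 //= => i _.
by rewrite alt ?subrr // -ltnS.
Qed.

Lemma boundaryZ n (a : int) (c : CR n) : boundary (a *: c) = a *: boundary c.
Proof. by rewrite -[a]intz !scaler_int raddfMz. Qed.

Lemma boundaryU n (x : n.-tuple X) : boundary << x >> = boundary_monomial x.
Proof. by rewrite /boundary liftU scale1r. Qed.

Lemma boundary_monomial_cycle n (x : n.-tuple X) :
  boundary (boundary_monomial x) = 0.
Proof.
case: n x => [|[|m]] x; try by rewrite /boundary_monomial big_ord0 raddf0.
pose mon (s : seq X) : CR m := oapp (fun t : m.-tuple X => << t >>) 0 (insub s).
pose F i j (e1 e2 : X -> X) := mon (cut e2 j (cut e1 i x)).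
pose T i j : CR m := (-1) ^+ (i + j) *:
  ((F i j id id - F i j id phi) - (F i j phi id - F i j phi phi)).
have faceE (h1 h2 : X -> X) (i : 'I_m.+1) (j : 'I_m) :
    << @face m.+1 h2 j (@face m.+2 h1 i x) >> = F i j h1 h2 :> CR m.
  rewrite /F /mon -[cut _ _ _]/(val (@face m.+1 h2 j (@face m.+2 h1 i x))).
  by rewrite valK.
transitivity (\sum_(i < m.+1) \sum_(j < m) T i j).
  rewrite raddf_sum; apply: eq_bigr => i _ /=.
  rewrite boundaryZ raddfB /= !boundaryU -sumrB scaler_sumr.
  by apply: eq_bigr => j _; rewrite -scalerBr scalerA -exprD !faceE.
apply: alternating_double_sum0 => i j leij.
have swap e1 e2 : (forall y, e1 (e2 y) = e2 (e1 y)) ->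
    F j.+1 i e1 e2 = F i j e2 e1.
  by move=> e12; rewrite /F (cut_cut _ e12 leij).
rewrite /T addSn addnC exprS mulN1r scaleNr !swap //.
by congr (- (_ *: _)); rewrite !opprD !opprK !addrA; congr (_ + _); rewrite addrAC.
Qed.

Lemma boundary_boundary n (c : CR n) : boundary (boundary c) = 0.
Proof.
rewrite -(freeg_sumE c) !raddf_sum big1 //= => x _.
rewrite {2}/boundary liftU boundaryZ boundary_monomial_cycle.
by rewrite scaler0.
Qed.

End ChainComplex.

Definition HR (n : nat) : zmodType := homology (@boundary n.+1) (@boundary n).

End RackHomology.

(* Main.v *)
(* Write xw for the tensor x (x) w, so that d(xw) = (1 - phi)w - x(dw), and fix
   a base point x0. The complex is spanned by aw, with a of augmentation 0, and
   by b(y,u) = x0 y u + (phi y - x0) x0 u, together with the element x0 in degree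
   1 and the unit in degree 0. In these coordinates
     d(aw) = - a(dw)   and   d b(y,u) = (y - phi y)u + b(y,du),
   so above degree 1 the complex is the tensor product of
   1 - phi : ZX -> ker(augmentation) with the complex itself, two degrees lower
   on ZX. As the orbits are finite, 1 - phi : ZX -> ZX has kernel ZS, spanned by
   the orbit sums, and cokernel ZS, and it splits integrally. Tensoring this
   contraction with the one known in lower degrees gives, by recursion on words,
   maps p and i between the complex and (ZS)^n with zero differential, and h with
   p i = 1 and d h + h d = 1 - i p. *)
Require Import Defs.
From HB Require Import structures.
From mathcomp Require Import all_boot all_order all_algebra.
From mathcomp Require Import generic_quotient ring_quotient.
From mathcomp Require Import boolp classical_sets cardinality.
From mathcomp.multinomials Require Import freeg.
From mathcomp Require Import ring.
Import GRing.Theory Num.Theory.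
Set Implicit Arguments.
Unset Strict Implicit.
Unset Printing Implicit Defensive.
Local Open Scope ring_scope.

(* A single constant for basis elements, since << x >> elaborates to several
   convertible but syntactically different terms. *)
Definition gen (K : choiceType) (x : K) : {freeg K / int} := << x >>.

Definition lin (K L : choiceType) (f : K -> {freeg L / int}) :
    {freeg K / int} -> {freeg L / int} :=
  fglift f.

Lemma linU (K L : choiceType) (f : K -> {freeg L / int}) x : lin f (gen x) = f x.
Proof. by rewrite /lin /gen liftU scale1r. Qed.

HB.instance Definition _ (K L : choiceType) (f : K -> {freeg L / int}) :=
  GRing.isZmodMorphism.Build {freeg K / int} {freeg L / int} (lin f)
    (lift_is_additive f).

Ltac freeg_abel :=
  apply/eqP/freeg_eqP => ?; rewrite ?(coeffD, coeffN, coeff0); ring.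

(** * Free abelian groups on words, and prefixing by a letter *)

Section FreegInt.
Variable K : choiceType.
Implicit Type D : {freeg K / int}.

(** Differences already yield negation and sums, hence every integer combination of basis elements.
    This reduces additive identities to basis elements. *)
Lemma freeg_int_ind (P : {freeg K / int} -> Prop) :
  (forall D1 D2, P D1 -> P D2 -> P (D1 - D2)) -> (forall x, P (gen x)) ->
  P 0 -> forall D, P D.
Proof.
move=> PB PU P0 D.
have PN E : P E -> P (- E) by move=> PE; rewrite -sub0r; apply: PB.
have PD E F : P E -> P F -> P (E + F).
  by move=> PE PF; rewrite -[F]opprK; apply: PB => //; apply: PN.
have PUk (k : nat) x : P << k%:Z *g x >>.
  elim: k => [|k IH]; first by rewrite freegU0.
  by rewrite intS -freegUD; apply: PD => //; apply: PU.
rewrite -(freeg_sumE D); elim/big_ind: _ => // x _.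
by case: (coeff x D) => n //; rewrite NegzE -freegUN; apply: PN.
Qed.

Lemma freeg_additive_ext (M : zmodType) (f g : {additive {freeg K / int} -> M}) :
  (forall x, f (gen x) = g (gen x)) -> f =1 g.
Proof.
move=> fg; apply: freeg_int_ind => [D E fD fE||] //; last by rewrite !raddf0.
by rewrite !raddfB fD fE.
Qed.

Lemma freeg_torsion_free (m : nat) D : (0 < m)%N -> D *+ m = 0 -> D = 0.
Proof.
move=> m_gt0 Dm; apply/eqP/freeg_eqP => x; apply/eqP.
have /(congr1 (coeff x)) := Dm; rewrite coeffMn coeff0 => /eqP.
by rewrite mulrn_eq0 eqn0Ngt m_gt0.
Qed.

Definition tens D (w : {freeg (seq K) / int}) : {freeg (seq K) / int} :=
  lin (fun x => lin (fun s => gen (x :: s)) w) D.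

Lemma tensU x s : tens (gen x) (gen s) = gen (x :: s).
Proof. by rewrite /tens !linU. Qed.

Lemma tensBl w : {morph tens^~ w : D E / D - E}.
Proof. by move=> D E; rewrite /tens raddfB. Qed.

Lemma tensBr D : {morph tens D : v w / v - w}.
Proof.
move=> v w; elim/freeg_int_ind: D => [D E|x|]; last by rewrite /tens !raddf0 addr0.
- by rewrite !tensBl => -> ->; freeg_abel.
- by rewrite /tens !linU raddfB.
Qed.

HB.instance Definition _ D :=
  GRing.isZmodMorphism.Build {freeg (seq K) / int} {freeg (seq K) / int} (tens D) (tensBr D).

Lemma tens0l w : tens 0 w = 0.
Proof. by rewrite /tens raddf0. Qed.

Lemma tens0r D : tens D 0 = 0. Proof. exact: raddf0. Qed.

Lemma tensNl D w : tens (- D) w = - tens D w.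
Proof. by rewrite -sub0r tensBl tens0l sub0r. Qed.

Lemma tensNr D w : tens D (- w) = - tens D w.
Proof. exact: raddfN. Qed.

Lemma tensDl w : {morph tens^~ w : D E / D + E}.
Proof. by move=> D E; rewrite /tens raddfD. Qed.

Lemma tensDr D : {morph tens D : v w / v + w}.
Proof. exact: raddfD. Qed.

End FreegInt.

Definition tensE := (tensDl, tensDr, tensNl, tensNr, tens0l, tens0r).

(** * Word length as the grading *)

Section Degree.
Variable K : choiceType.
Notation W := {freeg (seq K) / int}.

Definition trunc (n : nat) : W -> W :=
  lin (fun s => if size s == n then gen s else 0).
HB.instance Definition _ n := GRing.Additive.on (trunc n).

Definition of_tuples n : {freeg (n.-tuple K) / int} -> W :=
  lin (fun t => gen (val t)).
HB.instance Definition _ n := GRing.Additive.on (@of_tuples n).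

Definition to_tuples n : W -> {freeg (n.-tuple K) / int} :=
  lin (fun s => oapp (@gen (n.-tuple K)) 0 (insub s)).
HB.instance Definition _ n := GRing.Additive.on (@to_tuples n).

Lemma of_tuplesK n : cancel (@of_tuples n) (@to_tuples n).
Proof.
elim/freeg_int_ind => [D E|t|]; last by rewrite !raddf0.
  by rewrite !raddfB /= => -> ->.
by rewrite /of_tuples /to_tuples !linU valK.
Qed.

Lemma to_tuplesK n w : of_tuples (to_tuples n w) = trunc n w.
Proof.
elim/freeg_int_ind: w => [D E|s|]; last by rewrite !raddf0.
  by rewrite !raddfB /= => -> ->.
rewrite /to_tuples /trunc !linU; case: insubP => [t -> ts|/negbTE ->] /=.
  by rewrite /of_tuples linU ts.
exact: raddf0.
Qed.

Lemma trunc_neq m n w : m != n -> trunc n (trunc m w) = 0.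
Proof.
move=> mn; elim/freeg_int_ind: w => [D E|s|]; last by rewrite !raddf0.
  by rewrite !raddfB /= => -> ->; rewrite subrr.
rewrite /trunc linU; case: eqP => [sm|_]; last exact: raddf0.
by rewrite linU sm (negbTE mn).
Qed.

Lemma to_tuples_trunc m n w :
  to_tuples n (trunc m w) = if m == n then to_tuples n w else 0.
Proof.
case: eqVneq => [->|mn]; first by rewrite -to_tuplesK of_tuplesK.
by rewrite -[LHS]of_tuplesK to_tuplesK trunc_neq // raddf0.
Qed.

Lemma trunc_tens n a w : trunc n.+1 (tens a w) = tens a (trunc n w).
Proof.
elim/freeg_int_ind: a => [a b|x|]; last by rewrite !tens0l raddf0.
  by rewrite !tensBl raddfB /= => -> ->.
elim/freeg_int_ind: w => [v w|s|]; last by rewrite !raddf0.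
  by rewrite !(tensBr, raddfB) /= => -> ->.
rewrite tensU /trunc !linU /= eqSS; case: eqP => // _; last by rewrite raddf0.
by rewrite tensU.
Qed.

End Degree.

(** * The contraction *)

Section Contraction.
Variables (X S : choiceType) (phi : X -> X) (pr : X -> S) (rho : S -> X) (s0 : S).
Variables (tau : X -> {freeg X / int}) (N : S -> {freeg X / int}).
Notation W := {freeg (seq X) / int}.
Notation WS := {freeg (seq S) / int}.
Notation x0 := (rho s0).

Definition push : {freeg X / int} -> {freeg X / int} := lin (fun x => gen (phi x)).
HB.instance Definition _ := GRing.Additive.on push.
Definition phiW : W -> W := lin (fun s => gen (map phi s)).
HB.instance Definition _ := GRing.Additive.on phiW.
Definition tauX : {freeg X / int} -> {freeg X / int} := lin tau.
HB.instance Definition _ := GRing.Additive.on tauX.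
Definition rhoS : {freeg S / int} -> {freeg X / int} := lin (fun s => gen (rho s)).
HB.instance Definition _ := GRing.Additive.on rhoS.
Definition prX : {freeg X / int} -> {freeg S / int} := lin (fun x => gen (pr x)).
HB.instance Definition _ := GRing.Additive.on prX.
Definition NS : {freeg S / int} -> {freeg X / int} := lin N.
HB.instance Definition _ := GRing.Additive.on NS.

(* Reads off the coefficient at the last point of each orbit, so that the sum of
   the orbit s is sent to s. *)
Definition mark (x : X) : {freeg S / int} :=
  if phi x == rho (pr x) then gen (pr x) else 0.
Definition markX : {freeg X / int} -> {freeg S / int} := lin mark.
HB.instance Definition _ := GRing.Additive.on markX.

(** The class of x - x0 in the augmentation kernel of ZS, where a letter s other than s0 stands for
    the basis element s - s0. *)
Definition off_base (x : X) : {freeg S / int} := if pr x == s0 then 0 else gen (pr x).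

Definition shift : {freeg X / int} -> {freeg X / int} :=
  lin (fun x => gen (phi x) - gen x0).
HB.instance Definition _ := GRing.Additive.on shift.

Fixpoint d_seq (s : seq X) : W :=
  if s is x :: u then gen u - gen (map phi u) - tens (gen x) (d_seq u) else 0.
Definition dW : W -> W := lin d_seq.
HB.instance Definition _ := GRing.Additive.on dW.

(* b(a,w) in the notation above, extended linearly in a. *)
Definition based (a : {freeg X / int}) (w : W) : W :=
  tens (gen x0) (tens a w) + tens (shift a) (tens (gen x0) w).

(* The second component is the value of p at x0 s; it is a null-homotopy of
   p (1 - phi), see [p_d_P_d]. *)
Fixpoint p_seq (s : seq X) : WS * WS :=
  if s is x :: u then
    let: (v, v0) := p_seq u in
    (tens (off_base x) v + v0,
     tens (gen s0) (tens (mark x) v) - tens (off_base x) v0)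
  else (gen [::], gen [:: s0]).
Definition pW : W -> WS := lin (fun s => (p_seq s).1).
HB.instance Definition _ := GRing.Additive.on pW.
Definition PW : W -> WS := lin (fun s => (p_seq s).2).
HB.instance Definition _ := GRing.Additive.on PW.

(** A first letter s other than s0 stands for rho s - x0, and a pair s0 t for b(N t, _). The empty
    word and the word s0 give the two remaining generators, in degrees 0 and 1. *)
Fixpoint i_seq (v : seq S) : W :=
  if v is s :: v1 then
    if s == s0 then
      if v1 is t :: v2 then based (N t) (i_seq v2) else gen [:: x0]
    else tens (gen (rho s) - gen x0) (i_seq v1)
  else gen [::].
Definition iW : WS -> W := lin i_seq.
HB.instance Definition _ := GRing.Additive.on iW.

(* The value of h at aw for a of augmentation 0, given hw = h w. *)
Definition h_reduced (a : {freeg X / int}) (w hw : W) : W :=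
  based (tauX a) w - tens (rhoS (prX a)) hw.

(* The second component is the value of h at x0 s. *)
Fixpoint h_seq (s : seq X) : W * W :=
  if s is y :: u then
    let: (w, w0) := h_seq u in
    (h_reduced (gen y - gen x0) (gen u) w + w0,
     based (NS (mark y)) w - h_reduced (gen (phi y) - gen x0) (gen (x0 :: u)) w0)
  else (0, 0).
Definition hW : W -> W := lin (fun s => (h_seq s).1).
HB.instance Definition _ := GRing.Additive.on hW.
Definition h0W : W -> W := lin (fun s => (h_seq s).2).
HB.instance Definition _ := GRing.Additive.on h0W.

(* tau and N split 1 - phi: tau is inverse to it up to the base points rho on one
   side and up to the orbit sums N on the other. *)
Hypothesis pr_rho : forall s, pr (rho s) = s.
Hypothesis pr_phi : forall x, pr (phi x) = pr x.
Hypothesis tau_phi : forall x, tau x - push (tau x) = gen x - gen (rho (pr x)).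
Hypothesis phi_tau : forall x, tau x - tau (phi x) = gen x - NS (mark x).
Hypothesis push_N : forall s, push (N s) = N s.
Hypothesis mark_N : forall s, markX (N s) = gen s.

Lemma basedBl w : {morph based^~ w : a b / a - b}.
Proof. by move=> a b; rewrite /based !raddfB /= !tensE; freeg_abel. Qed.

Lemma basedBr a : {morph based a : v w / v - w}.
Proof. by move=> v w; rewrite /based !tensE; freeg_abel. Qed.

HB.instance Definition _ a := GRing.isZmodMorphism.Build W W (based a) (basedBr a).

Lemma based0l w : based 0 w = 0.
Proof. by rewrite /based !raddf0 !tensE addr0. Qed.

Lemma h_reducedBr a v v' w w' :
  h_reduced a (v - w) (v' - w') = h_reduced a v v' - h_reduced a w w'.
Proof. by rewrite /h_reduced raddfB /= !tensE; freeg_abel. Qed.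

Lemma h_reducedBl w hw : {morph (fun a => h_reduced a w hw) : a b / a - b}.
Proof. by move=> a b; rewrite /h_reduced !raddfB /= basedBl !tensE; freeg_abel. Qed.

Lemma d_tensU x w : dW (tens (gen x) w) = w - phiW w - tens (gen x) (dW w).
Proof.
elim/freeg_int_ind: w => [v w|s|]; last by rewrite !(raddf0, tens0r) !addr0.
  by rewrite !(raddfB, tensBr) /= => -> ->; freeg_abel.
by rewrite tensU /dW /phiW !linU /=.
Qed.

(** The values of [shift] have augmentation 0, so the copies of w - phi w cancel. *)
Lemma d_shift a w : dW (tens (shift a) w) = - tens (shift a) (dW w).
Proof.
elim/freeg_int_ind: a => [a b|x|]; last by rewrite !raddf0 !tensE !raddf0.
  by rewrite !(raddfB, tensBl) /= => -> ->; freeg_abel.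
by rewrite /shift linU !tensBl raddfB /= !d_tensU; freeg_abel.
Qed.

Lemma phiW_tensU x w : phiW (tens (gen x) w) = tens (gen (phi x)) (phiW w).
Proof.
elim/freeg_int_ind: w => [v w|s|]; last by rewrite !(raddf0, tens0r).
  by rewrite !(raddfB, tensBr) /= => -> ->.
by rewrite tensU /phiW !linU tensU.
Qed.

(** The [shift] term of [based] cancels x0 w, x0 phi(w) and phi(y) phi(w) out of d(x0 y w), leaving
    phi on the letter y only. *)
Lemma d_based a w : dW (based a w) = tens (a - push a) w + based a (dW w).
Proof.
elim/freeg_int_ind: a => [a b|y|].
- by rewrite !basedBl !raddfB /= => -> ->; rewrite !tensE; freeg_abel.
- rewrite /based raddfD /= d_shift !d_tensU phiW_tensU /shift /push !linU.
  by rewrite !tensE; freeg_abel.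
- by rewrite !(based0l, raddf0, addr0, tens0l).
Qed.

Lemma p_tensU x w : pW (tens (gen x) w) = tens (off_base x) (pW w) + PW w.
Proof.
elim/freeg_int_ind: w => [v w|s|]; last by rewrite !(raddf0, tens0r) addr0.
  by rewrite !(raddfB, tensBr) /= => -> ->; freeg_abel.
by rewrite tensU /pW /PW !linU /=; case: (p_seq s).
Qed.

Lemma P_tensU x w :
  PW (tens (gen x) w) =
    tens (gen s0) (tens (mark x) (pW w)) - tens (off_base x) (PW w).
Proof.
elim/freeg_int_ind: w => [v w|s|]; last by rewrite !(raddf0, tens0r) addr0.
  by rewrite !(raddfB, tensBr) /= => -> ->; freeg_abel.
by rewrite tensU /pW /PW !linU /=; case: (p_seq s).
Qed.

Lemma off_base_phi x : off_base (phi x) = off_base x.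
Proof. by rewrite /off_base pr_phi. Qed.

Lemma off_base_x0 : off_base x0 = 0.
Proof. by rewrite /off_base pr_rho eqxx. Qed.

(** As P w = p(x0 w), the second equation is p d (x0 w) = 0 in disguise. Each equation for xu uses
    those for u, so both go through one induction. *)
Lemma p_d_P_d w : pW (dW w) = 0 /\ PW (dW w) = pW w - pW (phiW w).
Proof.
elim/freeg_int_ind: w => [v w|s|]; last by rewrite !raddf0 addr0.
  rewrite !raddfB /= => -[-> ->] [-> ->]; split; freeg_abel.
elim: s => [|x u [pd Pd]].
  by rewrite /dW /phiW !linU /= !raddf0 subrr.
rewrite -tensU !d_tensU phiW_tensU !raddfB /= !p_tensU !P_tensU pd Pd off_base_phi.
by split; rewrite !tensE; freeg_abel.
Qed.

(** Since y and phi y share an orbit, the [shift] term of [based] contributes exactly what the last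
    term of [PW] subtracts. *)
Lemma p_based a w : pW (based a w) = tens (gen s0) (tens (markX a) (pW w)).
Proof.
elim/freeg_int_ind: a => [a b|y|].
- by rewrite basedBl !raddfB !tensE /= => -> ->.
- rewrite /based /shift !linU tensBl !raddfD raddfN /= !p_tensU !P_tensU.
  by rewrite /markX linU off_base_phi off_base_x0 !tensE; freeg_abel.
- by rewrite based0l !raddf0 !tensE.
Qed.

Lemma i_tens_s0 s w : iW (tens (gen s0) (tens (gen s) w)) = based (N s) (iW w).
Proof.
elim/freeg_int_ind: w => [v w|v|].
- by rewrite !(raddfB, tensBr) /= => -> ->.
- by rewrite !tensU /iW !linU /= eqxx.
- by rewrite !(raddf0, tens0r).
Qed.

Lemma i_tens s w : s != s0 ->
  iW (tens (gen s) w) = tens (gen (rho s) - gen x0) (iW w).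
Proof.
move=> ns; elim/freeg_int_ind: w => [v w|v|].
- by rewrite !(raddfB, tensBr) /= => -> ->.
- by rewrite !tensU /iW !linU /= (negbTE ns).
- by rewrite !(raddf0, tens0r).
Qed.

Lemma i_s0 : iW (gen [:: s0]) = gen [:: x0].
Proof. by rewrite /iW linU /= eqxx. Qed.

Lemma d_singleton x : dW (gen [:: x]) = 0.
Proof. by rewrite /dW linU /= subrr tens0r subrr. Qed.

Lemma d_i_p_i_gen v : dW (iW (gen v)) = 0 /\ pW (iW (gen v)) = gen v.
Proof.
pose Q v := dW (iW (gen v)) = 0 /\ pW (iW (gen v)) = gen v.
(* The rule for s0 t v strips two letters at once, so the induction carries v together with its
   one-letter extensions. *)
suff [] : Q v /\ forall s, Q (s :: v) by [].
have Qtens s u : s != s0 -> Q u -> Q (s :: u).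
  move=> ns [di pi]; rewrite /Q -tensU i_tens // tensBl !raddfB /=.
  rewrite !d_tensU !p_tensU di pi off_base_x0 /off_base pr_rho (negbTE ns).
  by split; rewrite !tensE; freeg_abel.
elim: v => [|t v [Qv Qtv]].
  have Q0 : Q [::] by rewrite /Q /iW /dW /pW !linU.
  split=> // s; have [->|/Qtens] := eqVneq s s0; last exact.
  rewrite /Q i_s0 d_singleton; split=> //.
  by rewrite /pW linU /= off_base_x0 tens0l add0r.
split=> // s; have [->|/Qtens] := eqVneq s s0; last exact.
(* Here d b(N t, i v) = (1 - phi)(N t) i v + b(N t, d i v), and N t is fixed by phi. *)
case: Qv => di pi; rewrite /Q -!tensU i_tens_s0 d_based di p_based pi push_N subrr.
by rewrite mark_N raddf0 tens0l addr0.
Qed.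

Lemma d_i v : dW (iW v) = 0.
Proof.
elim/freeg_int_ind: v => [v w|v|]; last by rewrite !raddf0.
  by rewrite !raddfB /= => -> ->; rewrite subrr.
by have [] := d_i_p_i_gen v.
Qed.

Lemma p_i v : pW (iW v) = v.
Proof.
elim/freeg_int_ind: v => [v w|v|]; last by rewrite !raddf0.
  by rewrite !raddfB /= => -> ->.
by have [] := d_i_p_i_gen v.
Qed.

Lemma p_d w : pW (dW w) = 0.
Proof. by have [] := p_d_P_d w. Qed.

Lemma h_tensU y w :
  hW (tens (gen y) w) = h_reduced (gen y - gen x0) w (hW w) + h0W w.
Proof.
elim/freeg_int_ind: w => [v w|s|].
- rewrite !(raddfB, tensBr) /= => -> ->.
  by rewrite h_reducedBr; freeg_abel.
- by rewrite tensU /hW /h0W !linU /=; case: (h_seq s).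
- by rewrite /h_reduced !(raddf0, tens0r) !addr0.
Qed.

Lemma h0_tensU y w :
  h0W (tens (gen y) w) = based (NS (mark y)) (hW w) -
    h_reduced (gen (phi y) - gen x0) (tens (gen x0) w) (h0W w).
Proof.
elim/freeg_int_ind: w => [v w|s|].
- by rewrite !(raddfB, tensBr) /= => -> ->; freeg_abel.
- by rewrite tensU /hW /h0W !linU /=; case: (h_seq s) => ? ?; rewrite tensU.
- by rewrite /h_reduced !(raddf0, tens0r, addr0).
Qed.

Lemma h_reduced0 w hw : h_reduced 0 w hw = 0.
Proof. by rewrite /h_reduced !raddf0 based0l tens0l subrr. Qed.

Lemma h_tensB y y' w :
  hW (tens (gen y - gen y') w) = h_reduced (gen y - gen y') w (hW w).
Proof. by rewrite tensBl raddfB /= !h_tensU !h_reducedBl; freeg_abel. Qed.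

Lemma h_tens_x0 w : hW (tens (gen x0) w) = h0W w.
Proof. by rewrite h_tensU subrr h_reduced0 add0r. Qed.

(** The second component of [h_seq] is obtained by solving this equation for h(x0 y u). *)
Lemma h_based a w : hW (based a w) = based (NS (markX a)) (hW w).
Proof.
elim/freeg_int_ind: a => [a b|y|].
- by rewrite basedBl !raddfB /= basedBl => -> ->.
- rewrite /based /shift linU raddfD /= h_tens_x0 h0_tensU h_tensB h_tens_x0.
  by rewrite /markX linU subrK.
- by rewrite !(based0l, raddf0).
Qed.

Lemma d_tensB x y w :
  dW (tens (gen x - gen y) w) = - tens (gen x - gen y) (dW w).
Proof. by rewrite !tensBl raddfB /= !d_tensU; freeg_abel. Qed.

Lemma tauX_push a : tauX a - push (tauX a) = a - rhoS (prX a).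
Proof.
elim/freeg_int_ind: a => [a b|x|]; last by rewrite !raddf0.
  move=> Ha Hb; transitivity ((tauX a - push (tauX a)) - (tauX b - push (tauX b))).
    by rewrite !raddfB /=; freeg_abel.
  by rewrite Ha Hb !raddfB /=; freeg_abel.
by rewrite /tauX /prX /rhoS !linU tau_phi.
Qed.

Lemma tauX_sub_push a : tauX (a - push a) = a - NS (markX a).
Proof.
elim/freeg_int_ind: a => [a b|x|]; last by rewrite !(raddf0, addr0).
  move=> Ha Hb; transitivity (tauX (a - push a) - tauX (b - push b)).
    by rewrite !raddfB /=; freeg_abel.
  by rewrite Ha Hb !raddfB /=; freeg_abel.
by rewrite /push linU /tauX /markX raddfB /= !linU phi_tau.
Qed.

Definition contracts w := dW (hW w) + hW (dW w) = w - iW (pW w).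

Lemma contractsB v w : contracts v -> contracts w -> contracts (v - w).
Proof.
rewrite /contracts !raddfB /= => Hv Hw.
transitivity (dW (hW v) + hW (dW v) - (dW (hW w) + hW (dW w))); first by freeg_abel.
by rewrite Hv Hw; freeg_abel.
Qed.

Lemma i_p_tensB x w :
  iW (pW (tens (gen x - gen x0) w)) =
    tens (rhoS (prX (gen x - gen x0))) (iW (pW w)).
Proof.
have -> : rhoS (prX (gen x - gen x0)) = gen (rho (pr x)) - gen x0.
  by rewrite !raddfB /= /prX !linU /rhoS !linU pr_rho.
rewrite tensBl raddfB /= !p_tensU off_base_x0 tens0l add0r addrK /off_base.
have [->|ns] := eqVneq; first by rewrite subrr !tens0l raddf0.
by rewrite i_tens.
Qed.

(** With R = rho pr and a = x - x0, [tau_phi] gives d b(tau a, w) = (a - R a) w + b(tau a, d w). The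
    last term cancels against h d, and the identity for w turns R a (d h + h d) w into R a (w - i p
    w). *)
Lemma contracts_tensB x w :
  contracts w -> contracts (tens (gen x - gen x0) w).
Proof.
move=> Hw; rewrite /contracts d_tensB raddfN /= !h_tensB i_p_tensB /h_reduced.
set a := gen x - gen x0; have := tauX_push a.
have Ra : rhoS (prX a) = gen (rho (pr x)) - gen x0.
  by rewrite !raddfB /= /prX !linU /rhoS !linU pr_rho.
move=> Ta; rewrite raddfB /= d_based {}Ta Ra d_tensB -Ra tensBl.
have -> : iW (pW w) = w - (dW (hW w) + hW (dW w)) by rewrite Hw; freeg_abel.
by rewrite !tensE; freeg_abel.
Qed.

Lemma push_NS a : push (NS a) = NS a.
Proof.
elim/freeg_int_ind: a => [a b|s|]; last by rewrite !raddf0.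
  by rewrite !raddfB /= => -> ->.
by rewrite /NS linU push_N.
Qed.

Lemma i_tens_s0_mark y v :
  iW (tens (gen s0) (tens (mark y) v)) = based (NS (mark y)) (iW v).
Proof.
rewrite /mark; case: ifP => _; last by rewrite !tensE !raddf0 based0l.
by rewrite i_tens_s0 /NS linU.
Qed.

(** The mirror image: [phi_tau] turns h((y - phi y) w) into b(y - N mark y, w), and the identity for
    w supplies the rest, N mark y being fixed by phi. *)
Lemma contracts_based y w : contracts w -> contracts (based (gen y) w).
Proof.
move=> Hw; rewrite /contracts h_based !d_based p_based raddfD /= h_based push_NS subrr.
have -> : markX (gen y) = mark y by rewrite /markX linU.
have py : push (gen y) = gen (phi y) by rewrite /push linU.
rewrite i_tens_s0_mark {1}py h_tensB /h_reduced -py tauX_sub_push.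
have -> : rhoS (prX (gen y - push (gen y))) = 0.
  by rewrite raddfB /= py /prX !linU pr_phi subrr raddf0.
have -> : markX (gen y) = mark y by rewrite /markX linU.
have -> : iW (pW w) = w - (dW (hW w) + hW (dW w)) by rewrite Hw; freeg_abel.
by rewrite basedBl !raddfB raddfD /= !tens0l; freeg_abel.
Qed.

Lemma contractsP w : contracts w.
Proof.
have c0 : contracts 0 by rewrite /contracts !raddf0 !addr0.
elim/freeg_int_ind: w => [v w|s|//]; first exact: contractsB.
(* Both yu = (y - x0)u + x0 u and x0 y u = b(y,u) - (phi y - x0) x0 u reduce to u and x0 u, so these
   two are treated together. *)
suff [] : contracts (gen s) /\ contracts (tens (gen x0) (gen s)) by [].
elim: s => [|y s [Hs Hx0s]].
  have p_x0 : pW (gen [:: x0]) = gen [:: s0].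
    by rewrite /pW linU /= off_base_x0 tens0l add0r.
  have h_x0 : hW (gen [:: x0]) = 0 by rewrite /hW linU /= subrr h_reduced0 addr0.
  rewrite /contracts tensU d_singleton p_x0 i_s0 h_x0 !raddf0 subrr addr0; split=> //.
  by rewrite /dW /hW /pW /iW !linU /= !raddf0 subrr addr0.
rewrite -tensU; split.
  have -> : tens (gen y) (gen s) =
      tens (gen y - gen x0) (gen s) - (0 - tens (gen x0) (gen s)).
    by rewrite tensBl; freeg_abel.
  by apply: contractsB; [exact: contracts_tensB|exact: contractsB].
have -> : tens (gen x0) (tens (gen y) (gen s)) =
    based (gen y) (gen s) - tens (gen (phi y) - gen x0) (tens (gen x0) (gen s)).
  by rewrite /based /shift linU addrK.
by apply: contractsB; [exact: contracts_based|exact: contracts_tensB].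
Qed.

(** Preservation of length by i is what lets the contraction of the whole word complex be read in a
    single degree. *)
Lemma trunc_i v : trunc (size v) (iW (gen v)) = iW (gen v).
Proof.
have trunc_based n a w : trunc n.+2 (based a w) = based a (trunc n w).
  by rewrite /based raddfD /= !trunc_tens.
pose Q v := trunc (size v) (iW (gen v)) = iW (gen v).
suff [] : Q v /\ forall s, Q (s :: v) by [].
have Qtens s u : s != s0 -> Q u -> Q (s :: u).
  by move=> ns Qu; rewrite /Q -tensU i_tens //= trunc_tens Qu.
elim: v => [|t v [Qv Qtv]].
  have Q0 : Q [::] by rewrite /Q /iW /trunc !linU.
  split=> // s; have [->|/Qtens] := eqVneq s s0; last exact.
  by rewrite /Q i_s0 /trunc linU.
split=> // s; have [->|/Qtens] := eqVneq s s0; last exact.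
by rewrite /Q -!tensU i_tens_s0 trunc_based Qv.
Qed.

End Contraction.

(** * Orbits of the permutation *)

Section FiniteOrbits.
Variables (X : permRack) (psi : X -> X).
Notation phi := (rack_perm X).
Hypotheses (phiK : cancel phi psi) (psiK : cancel psi phi).
Hypothesis finite_orbits : forall x : X, finite_set (orbit_of x).

Definition orb (x : X) : orbits X := (\pi x)%qT.
Definition base (s : orbits X) : X := repr s.

Lemma orb_base s : orb (base s) = s.
Proof. exact: reprK. Qed.

Lemma same_orbit_iter x k : same_orbit x (iter k phi x).
Proof. by apply/asboolP; exists k; left. Qed.

Lemma orb_iter k x : orb (iter k phi x) = orb x.
Proof. by apply/esym/eqmodP; exact: same_orbit_iter. Qed.

(** Pigeonhole: if r enumerates the orbit, two of the first [(size r).+1] iterates agree, and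
    injectivity of phi cancels the smaller exponent. *)
Lemma phi_periodic x : exists2 m, (0 < m)%N & iter m phi x = x.
Proof.
have /finite_seqP[r rE] := finite_orbits x.
pose t := [seq iter k phi x | k <- iota 0 (size r).+1].
have t_r : {subset t <= r}.
  move=> _ /mapP[k _ ->]; have : orbit_of x (iter k phi x) by exact: same_orbit_iter.
  by rewrite rE.
have /(uniqPn x) [j [k [ltjk ltk]]] : ~~ uniq t.
  by apply/negP => /uniq_leq_size /(_ t_r); rewrite size_map size_iota ltnn.
rewrite size_map size_iota in ltk.
rewrite !(nth_map 0%N) ?size_iota ?(ltn_trans ltjk) // !nth_iota ?(ltn_trans ltjk) //.
rewrite !add0n -(subnKC (ltnW ltjk)) iterD => /iter_phi_inj eqx.
by exists (k - j)%N; rewrite ?subn_gt0.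
Qed.

(** If the base point is phi^k x instead, a period m of x replaces phi^(-k) by phi^(m k - k). *)
Lemma reach x : exists k, iter k phi (base (orb x)) == x.
Proof.
have /eqmodP /asboolP[k [xE|bE]] : (base (orb x) = x %[mod orbits X])%qT.
- exact: orb_base.
- by exists k; rewrite -xE.
have [m m_gt0 mx] := phi_periodic x.
have mkx : iter (m * k) phi x = x.
  by elim: (k) => [|j IH]; rewrite ?muln0 // mulnS iterD IH.
exists (m * k - k)%N; rewrite bE -iterD subnK ?mkx //.
by rewrite leq_pmull.
Qed.

Definition height x := ex_minn (reach x).

Lemma iter_height x : iter (height x) phi (base (orb x)) = x.
Proof. by rewrite /height; case: ex_minnP => k /eqP. Qed.

Lemma height_min x k : iter k phi (base (orb x)) = x -> (height x <= k)%N.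
Proof. by move=> kx; rewrite /height; case: ex_minnP => j _; apply; apply/eqP. Qed.

Lemma orb_phi x : orb (phi x) = orb x.
Proof. exact: (orb_iter 1). Qed.

(** A shortest path from the base point to phi x has positive length, so by injectivity of phi it
    passes through x just before its end. *)
Lemma heightS x : phi x != base (orb x) -> height (phi x) = (height x).+1.
Proof.
move=> nb; have := @height_min (phi x); have := iter_height (phi x).
rewrite orb_phi; case: (height _) => [|j] /= Hj min.
  by rewrite -Hj eqxx in nb.
apply/eqP; rewrite eqn_leq min /= ?iter_height // ltnS.
by apply: height_min; apply: (can_inj phiK).
Qed.

Definition arc (x : X) (k : nat) : {freeg X / int} :=
  \sum_(j < k) gen (iter j phi x).

(** Minus the sum of the points strictly before x on its orbit; applying 1 - phi telescopes this to
    x minus the base point. *)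
Definition orbit_tau (x : X) : {freeg X / int} := - arc (base (orb x)) (height x).

(* psi is the inverse of phi, and psi (base s) is the last point of the orbit. *)
Definition orbit_norm (s : orbits X) : {freeg X / int} :=
  arc (base s) (height (psi (base s))).+1.

Lemma arcS x k : arc x k.+1 = arc x k + gen (iter k phi x).
Proof. by rewrite /arc big_ord_recr. Qed.

Lemma push_arc x k : push phi (arc x k) = arc x k + gen (iter k phi x) - gen x.
Proof.
rewrite -arcS /arc raddf_sum big_ord_recl /= addrAC subrr add0r.
by apply: eq_bigr => j _; rewrite /push linU.
Qed.

Lemma orb_psi x : orb (psi x) = orb x.
Proof. by rewrite -{2}(psiK x) orb_phi. Qed.

Lemma iter_height_psi s : iter (height (psi (base s))) phi (base s) = psi (base s).
Proof. by have := iter_height (psi (base s)); rewrite orb_psi orb_base. Qed.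

Lemma push_orbit_norm s : push phi (orbit_norm s) = orbit_norm s.
Proof. by rewrite push_arc /= iter_height_psi psiK addrK. Qed.

Lemma orbit_tau_push x :
  orbit_tau x - push phi (orbit_tau x) = gen x - gen (base (orb x)).
Proof. by rewrite /orbit_tau raddfN /= push_arc iter_height; freeg_abel. Qed.

(** Passing from x to phi x adds the point x to the arc, except at the last point of the orbit:
    there the height falls back to 0 and the full orbit sum appears. *)
Lemma orbit_tau_phi x :
  orbit_tau x - orbit_tau (phi x) =
    gen x - NS orbit_norm (mark phi orb base x).
Proof.
rewrite /mark /orbit_tau orb_phi; case: eqP => [phix|/eqP nb].
  rewrite /NS linU /orbit_norm -phix phiK.
  have -> : height (phi x) = 0%N.
    by apply/eqP; rewrite -leqn0; apply: height_min; rewrite orb_phi phix.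
  have -> : arc (phi x) 0 = 0 by rewrite /arc big_ord0.
  have iterx : iter (height x) phi (phi x) = x by rewrite phix iter_height.
  by rewrite arcS iterx; freeg_abel.
by rewrite heightS // arcS iter_height raddf0; freeg_abel.
Qed.

(** Only the last term of the arc is sent by phi to the base point; an earlier one would contradict
    the minimality of the height. *)
Lemma mark_orbit_norm s : markX phi orb base (orbit_norm s) = gen s.
Proof.
rewrite /orbit_norm /arc raddf_sum /= big_ord_recr /= big1 ?add0r => [|j _].
  rewrite iter_height_psi /markX linU /mark psiK orb_psi.
  by rewrite orb_base eqxx.
rewrite /markX linU /mark orb_iter orb_base; case: eqP => // jb.
have: (height (psi (base s)) <= j)%N; last by rewrite leqNgt ltn_ord.
by apply: height_min; rewrite orb_psi orb_base; apply: (can_inj phiK); rewrite psiK.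
Qed.

End FiniteOrbits.

(** * The rack complex *)

Section Bridge.
Variable X : permRack.
Notation phi := (rack_perm X).

Definition cut (g : X -> X) (k : nat) (s : seq X) : seq X :=
  take k s ++ [seq g y | y <- drop k.+1 s].

(** The term k = 0 is u - phi u. The later faces keep the first letter, which shifts k by one and
    accounts for the sign in the recursion. *)
Lemma d_seqE (s : seq X) :
  d_seq phi s =
    \sum_(k < (size s).-1) (-1) ^+ k *: (gen (cut id k s) - gen (cut phi k s)).
Proof.
elim: s => [|x [|y u] IH]; first by rewrite big_ord0.
  by rewrite /= !subrr tens0r subrr big_ord0.
have -> : d_seq phi (x :: y :: u) =
    gen (y :: u) - gen (map phi (y :: u)) - tens (gen x) (d_seq phi (y :: u)) by [].
rewrite IH big_ord_recl expr0 scale1r /cut /= map_id; congr (_ + _).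
rewrite raddf_sum -sumrN; apply: eq_bigr => k _.
by rewrite raddfZsign raddfB /= !tensU exprS mulN1r scaleNr.
Qed.

Lemma d_of_tuples n (c : CR X n) : dW phi (of_tuples c) = of_tuples (boundary c).
Proof.
elim/freeg_int_ind: c => [a b|t|]; last by rewrite !raddf0.
  by rewrite !raddfB /= => -> ->.
have -> : boundary (gen t) = boundary_monomial t by exact: boundaryU.
rewrite /of_tuples /dW !linU d_seqE size_tuple raddf_sum; apply: eq_bigr => k _.
rewrite raddfZsign; congr (_ *: _).
by rewrite raddfB /=; congr (_ - _); exact/esym/linU.
Qed.

Lemma boundary_to_tuples n w :
  boundary (to_tuples n.+1 w : CR X n.+1) = to_tuples n (dW phi w).
Proof.
elim/freeg_int_ind: w => [a b|s|]; last by rewrite !raddf0.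
  by rewrite !raddfB /= => -> ->.
have sE : gen s = of_tuples (gen (in_tuple s)) by rewrite /of_tuples linU.
have [sn|ns] := eqVneq (size s) n.+1.
  move: (in_tuple s) sE; rewrite sn => t ->.
  by rewrite of_tuplesK d_of_tuples of_tuplesK.
have -> : to_tuples n.+1 (gen s) = 0.
  by rewrite /to_tuples linU insubN.
rewrite raddf0 sE d_of_tuples -[boundary _]of_tuplesK to_tuplesK to_tuples_trunc.
(* The lengths can still match when s is empty and n = 0, since [0.-1] is 0; there the boundary is
   an empty sum. *)
case: eqP => // sn; case: s ns sE sn => [|x s] /= ns _.
  move=> _; have -> : boundary (gen (in_tuple [::])) = 0 :> CR X 0.
    by rewrite boundaryU /boundary_monomial big_ord0.
  by rewrite !raddf0.
by move=> sn; rewrite sn eqxx in ns.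
Qed.

End Bridge.

(** * From a contraction to the homology groups *)

Section HomologyIso.
Variables (A B C M : zmodType).
Variables (f : {additive A -> B}) (g : {additive B -> C}) (q : {additive B -> M}).
Hypothesis qf : forall a, q (f a) = 0.
Hypothesis q_ker : forall z, g z = 0 -> q z = 0 -> exists a, f a = z.
Hypothesis q_onto : forall m, exists2 z, g z = 0 & q z = m.

Definition homology_map (c : homology f g) : M := q (cycle_val (repr c)).

(** Two representatives differ by a boundary, which q kills, so the chosen one does not matter. *)
Lemma homology_map_pi (z : cycles g) :
  homology_map (\pi_(homology f g) z)%qT = q (cycle_val z).
Proof.
have /eqmodP : (repr (\pi_(homology f g) z) = z %[mod homology f g])%qT by rewrite reprK.
rewrite /= Quotient.equivE => /asboolP[a fa].
rewrite /homology_map; apply/eqP; rewrite -subr_eq0 -raddfB.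
have fa' : f a = cycle_val _ - cycle_val z := fa.
by rewrite -fa' qf.
Qed.

Lemma homology_map_additive : zmod_morphism homology_map.
Proof.
move=> c d; rewrite -[c]reprK -[d]reprK -raddfB /= !homology_map_pi.
by rewrite -raddfB.
Qed.

HB.instance Definition _ :=
  GRing.isZmodMorphism.Build (homology f g) M homology_map homology_map_additive.

Lemma homology_map_bij : bijective homology_map.
Proof.
have inj : injective homology_map.
  apply: raddf_inj => c; rewrite -[c]reprK.
  case: (repr c) => z gz c0.
  have qz : q z = 0.
    by rewrite -c0; exact: esym (homology_map_pi (Cycles gz)).
  have [a fa] := q_ker (eqP gz) qz.
  rewrite -(raddf0 (\pi_(homology f g)%qT)).
  apply/eqmodP; rewrite /= Quotient.equivE subr0.
  by apply/asboolP; exists a.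
have sur m : exists c, homology_map c = m.
  have [z gz qz] := q_onto m.
  have zc : z \in Defs.cycle g by rewrite inE gz.
  by exists (\pi_(homology f g) (Cycles zc))%qT; rewrite homology_map_pi.
pose inv m := projT1 (cid (sur m)).
have invK : cancel inv homology_map by move=> m; rewrite /inv; case: cid.
by exists inv => // c; apply: inj; rewrite invK.
Qed.

Lemma homology_iso : exists F : {additive homology f g -> M}, bijective F.
Proof. by exists homology_map; exact: homology_map_bij. Qed.

End HomologyIso.

(** The isomorphism is induced by q. A cycle z killed in degree n is the boundary of the degree n +
    1 part of k z, and j provides preimages; [to_tuples] projects to the right length. *)
Lemma HR_iso_of_contraction (X : permRack) (S : choiceType)
    (q : {additive {freeg (seq X) / int} -> {freeg (seq S) / int}})
    (j : {additive {freeg (seq S) / int} -> {freeg (seq X) / int}})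
    (k : {additive {freeg (seq X) / int} -> {freeg (seq X) / int}}) (n : nat) :
  (forall w, q (dW (rack_perm X) w) = 0) ->
  (forall v, dW (rack_perm X) (j v) = 0) ->
  (forall v, q (j v) = v) ->
  (forall w, dW (rack_perm X) (k w) + k (dW (rack_perm X) w) = w - j (q w)) ->
  (forall v, trunc (size v) (j (gen v)) = j (gen v)) ->
  exists f : {additive HR X n -> {freeg (n.-tuple S) / int}}, bijective f.
Proof.
move=> qd dj qj htpy truncj.
have to_tuples_j w : to_tuples n (j w) = to_tuples n (j (trunc n w)).
  elim/freeg_int_ind: w => [v w|v|]; last by rewrite !raddf0.
    by rewrite !raddfB /= => -> ->.
  rewrite /trunc linU -(truncj v) to_tuples_trunc; case: eqP => // _.
  by rewrite !raddf0.
have trunc_j w : trunc n (j (of_tuples w)) = j (@of_tuples _ n w).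
  elim/freeg_int_ind: w => [v w|t|]; last by rewrite !raddf0.
    by rewrite !raddfB /= => -> ->.
  by rewrite /of_tuples linU -{1}(size_tuple t) truncj.
pose P : {additive CR X n -> {freeg (n.-tuple S) / int}} :=
  @to_tuples S n \o (q \o @of_tuples X n).
apply: (@homology_iso _ _ _ _ _ _ P) => [c|z dz Pz|v].
- have E : dW (rack_perm X) (of_tuples c) = @of_tuples X n (boundary c).
    exact: d_of_tuples.
  by rewrite /= -E qd raddf0.
- exists (to_tuples n.+1 (k (of_tuples z))).
  transitivity (to_tuples n (dW (rack_perm X) (k (of_tuples z)))).
    exact: boundary_to_tuples.
  have -> : dW (rack_perm X) (k (of_tuples z)) = of_tuples z - j (q (of_tuples z)).
    by rewrite -htpy d_of_tuples dz !raddf0 addr0.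
  rewrite raddfB /= of_tuplesK to_tuples_j -to_tuplesK.
  have -> : to_tuples n (q (of_tuples z)) = 0 by exact: Pz.
  by rewrite !raddf0 addr0.
- exists (to_tuples n (j (of_tuples v))); last first.
    by rewrite /= to_tuplesK trunc_j qj of_tuplesK.
  (* [boundary_to_tuples] covers positive degrees; in degree 0 the boundary is an empty sum and
     every chain is a cycle. *)
  case: (n) v => [|m] v; last by rewrite /= boundary_to_tuples dj raddf0.
  elim/freeg_int_ind: (to_tuples _ _) => [a b|t|]; last by rewrite raddf0.
    by rewrite !raddfB /= => -> ->; rewrite subrr.
  by rewrite /= boundaryU /boundary_monomial big_ord0.
Qed.

(* Without a point of X there is no base point x0, but only the empty word. *)
Lemma HR_iso_empty (X : permRack) (n : nat) :
  (X -> False) ->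
  exists f : {additive HR X n -> {freeg (n.-tuple (orbits X)) / int}}, bijective f.
Proof.
move=> X0.
have seqX (s : seq X) : s = [::] by case: s => // x; case: (X0 x).
have seqS (v : seq (orbits X)) : v = [::] by case: v => // s; case: (X0 (base s)).
pose q : {additive {freeg (seq X) / int} -> {freeg (seq (orbits X)) / int}} :=
  lin (fun=> gen [::]).
pose j : {additive {freeg (seq (orbits X)) / int} -> {freeg (seq X) / int}} :=
  lin (fun=> gen [::]).
pose k : {additive {freeg (seq X) / int} -> {freeg (seq X) / int}} := lin (fun=> 0).
have d0 w : dW (rack_perm X) w = 0.
  elim/freeg_int_ind: w => [v w|s|]; last by rewrite raddf0.
    by rewrite raddfB /= => -> ->; rewrite subrr.
  by rewrite (seqX s) /dW linU.
apply: (@HR_iso_of_contraction _ _ q j k) => [w|v|v|w|v].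
- by rewrite d0 raddf0.
- exact: d0.
- apply: (@freeg_additive_ext _ _ (q \o j) idfun) => {}v.
  by rewrite (seqS v) /= !linU.
- rewrite !d0 raddf0 addr0; apply/esym/eqP; rewrite subr_eq0; apply/eqP.
  apply: (@freeg_additive_ext _ _ idfun (j \o q)) => s.
  by rewrite (seqX s) /= !linU.
- by rewrite (seqS v) /= linU /trunc linU.
Qed.

Theorem theoremD (X : permRack)
    (finite_orbits : forall x : X, finite_set (orbit_of x)) (n : nat) :
  (exists f : {additive HR X n -> {freeg (n.-tuple (orbits X)) / int}},
     bijective f) /\
  (forall (m : nat) (z : HR X n), (0 < m)%N -> z *+ m = 0 -> z = 0).
Proof.
have iso : exists f : {additive HR X n -> {freeg (n.-tuple (orbits X)) / int}},
    bijective f.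
  (* A point x supplies the base orbit s0 = [orb x]. *)
  have [[x _]|X0] := pselect (exists x : X, True); last first.
    by apply: HR_iso_empty => x; apply: X0; exists x.
  have [psi phiK psiK] := rack_perm_bij X.
  pose tau := orbit_tau finite_orbits; pose N := orbit_norm psi finite_orbits.
  have pr_rho := @orb_base X.
  have pr_phi := @orb_phi X.
  have tau_phi := orbit_tau_push finite_orbits.
  have phi_tau := orbit_tau_phi phiK finite_orbits.
  have push_N := push_orbit_norm psiK finite_orbits.
  have mark_N := mark_orbit_norm phiK psiK finite_orbits.
  apply: (@HR_iso_of_contraction _ _
    (pW (rack_perm X) (@orb X) (@base X) (orb x))
    (iW (rack_perm X) (@base X) (orb x) N)
    (hW (rack_perm X) (@orb X) (@base X) (orb x) tau N)).
  - exact: p_d.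
  - exact: d_i.
  - exact: p_i.
  - exact: contractsP.
  - exact: trunc_i.
split=> //; have [f /bij_inj f_inj] := iso.
move=> m z m_gt0 mz; apply: f_inj; rewrite raddf0.
by apply: (freeg_torsion_free m_gt0); rewrite -raddfMn mz raddf0.
Qed.
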